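(* Let $\Lambda$ be a finite dimensional algebra over a field and $k\ge1$ an integer. Then $$k\text{-}\operatorname{edell}\Lambda\le k\text{-}\operatorname{ddell}\Lambda\le k\text{-}\operatorname{dell}\Lambda .$$
   Context: Modules are right $\Lambda$-modules; $\mathrm{mod}\,\Lambda$ denotes the category of finitely generated ones. $\mathbb N$ is the set of nonnegative integers; the infimum of the empty set is $+\infty$. $\Omega M$ is the kernel of a projective cover of $M$, $\Omega^0M=M$, $\Omega^{n+1}M=\Omega(\Omega^nM)$. ''$A$ is a direct summand of $B$ up to projective summands'' means that $A$ is isomorphic to a direct summand of $B\oplus P$ for some projective $P$. For an integer $j\ge1$, $j\text{-}\operatorname{dell}M$ is the infimum of all $n\in\mathbb N$ such that $\Omega^nM$ is a direct summand of $\Omega^{n+j}N$ up to projective summands for some $N\in\mathrm{mod}\,\Lambda$. $k\text{-}\operatorname{edell}M$ is the infimum of all $n\in\mathbb N$ such that for every integer $k'\ge1$ and every right $\Lambda$-module $X$ of injective dimension $\mathrm{id}\,X=n+k-1+k'$ one has $\mathrm{Ext}_\Lambda^{n+k'}(M,X)=0$. $k\text{-}\operatorname{ddell}M$ is the infimum of all $m\in\mathbb N$ for which there exist an integer $0\le n\le m$ and an exact sequence $0\to C_n\to C_{n-1}\to\cdots\to C_1\to C_0\to M\to0$ in $\mathrm{mod}\,\Lambda$ with $(i+k)\text{-}\operatorname{dell}C_i\le m-i$ for $i=0,1,\dots,n$. For each of these three invariants, the value on $\Lambda$ is the supremum of the values on the simple right $\Lambda$-modules. *)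

(* Defs.v *)
From HB Require Import structures.
From mathcomp Require Import all_boot all_order all_algebra all_field.
From mathcomp Require Import all_classical all_reals ereal.

Set Implicit Arguments.
Unset Strict Implicit.
Unset Printing Implicit Defensive.

Import Order.TTheory GRing.Theory Num.Theory.
Local Open Scope classical_set_scope.
Local Open Scope ring_scope.

(* A right module over Lambda is a left module over the converse ring
   Lambda^c.  The notions below are developed for left A-modules and are
   instantiated at A := Lambda^c at the end of the file. *)
Notation rmodType Lambda := (lmodType (Lambda^c)%type).

Section Modules.
Variable A : nzRingType.
Implicit Types K L M N P X : lmodType A.

Definition surjective_fun (T U : Type) (f : T -> U) : Prop :=
  forall y, exists x, f x = y.

Definition exact_at M N X (f : {linear M -> N}) (g : {linear N -> X}) : Prop :=
  forall y, g y = 0 <-> exists x, f x = y.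

Definition zero_mod M : Prop := forall x : M, x = 0.

Definition fin_gen M : Prop :=
  exists (n : nat) (e : 'I_n -> M),
    forall x : M, exists c : 'I_n -> A, x = \sum_(i < n) c i *: e i.

Definition simple_mod M : Prop :=
  (exists x : M, x <> 0) /\
  forall U : {pred M}, submod_closed U ->
    (forall x, x \in U -> x = 0) \/ (forall x, x \in U).

Definition iso_mod M N : Prop := exists f : {linear M -> N}, bijective f.

Definition projective_mod P : Prop :=
  forall M N (g : {linear M -> N}) (f : {linear P -> N}),
    surjective_fun g -> exists h : {linear P -> M}, forall x, g (h x) = f x.

Definition injective_mod X : Prop :=
  forall M N (i : {linear M -> N}) (f : {linear M -> X}),
    injective i -> exists h : {linear N -> X}, forall x, h (i x) = f x.

(* A projective cover is an essential epimorphism from a projective module. *)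
Definition projective_cover P M (p : {linear P -> M}) : Prop :=
  [/\ projective_mod P, surjective_fun p &
      forall N (g : {linear N -> P}),
        surjective_fun (fun x => p (g x)) -> surjective_fun g].

(* Omega^n M is only defined up to isomorphism, so it is given as a relation:
   [is_syz n M K] says that K is (a copy of) Omega^n M. *)
Definition is_syzygy M K : Prop :=
  exists P (p : {linear P -> M}) (i : {linear K -> P}),
    [/\ projective_cover p, injective i & exact_at i p].

Fixpoint is_syz (n : nat) M K : Prop :=
  match n with
  | 0 => iso_mod M K
  | n'.+1 => exists L : lmodType A, is_syz n' M L /\ is_syzygy L K
  end.

Definition stable_summand M N : Prop :=
  exists P C : lmodType A,
    projective_mod P /\ iso_mod (M * C)%type (N * P)%type.

(* ... -> C_1 -> C_0 -> M -> 0 exact.  A finite exact sequence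
   0 -> C_n -> ... -> C_0 -> M -> 0 is one with C_i = 0 for i > n. *)
Record resolution M := Resolution {
  res_obj : nat -> lmodType A;
  res_d : forall i, {linear res_obj i.+1 -> res_obj i};
  res_aug : {linear res_obj 0 -> M};
  res_aug_surj : surjective_fun res_aug;
  res_exact0 : exact_at (res_d 0) res_aug;
  res_exactS : forall i, exact_at (res_d i.+1) (res_d i) }.

Record coresolution X := Coresolution {
  cores_obj : nat -> lmodType A;
  cores_d : forall i, {linear cores_obj i -> cores_obj i.+1};
  cores_aug : {linear X -> cores_obj 0};
  cores_aug_inj : injective cores_aug;
  cores_exact0 : exact_at cores_aug (cores_d 0);
  cores_exactS : forall i, exact_at (cores_d i) (cores_d i.+1) }.

(* n-cocycles and n-coboundaries of the complex Hom(P_*, X), P_(-1) = 0. *)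
Definition cocycle M X (P : resolution M) n
    (f : {linear res_obj P n -> X}) : Prop :=
  forall x, f (res_d P n x) = 0.

Definition coboundary M X (P : resolution M) n :
    {linear res_obj P n -> X} -> Prop :=
  match n return {linear res_obj P n -> X} -> Prop with
  | 0 => fun f => forall x, f x = 0
  | n'.+1 => fun f => exists g : {linear res_obj P n' -> X},
                        forall x, f x = g (res_d P n' x)
  end.

(* Ext^n(M, X) = 0, i.e. H^n(Hom(P_*, X)) = 0 for the projective resolutions
   P_* of M; these exist, and the condition does not depend on P_*. *)
Definition ext_zero n M X : Prop :=
  forall P : resolution M, (forall i, projective_mod (res_obj P i)) ->
  forall f : {linear res_obj P n -> X}, cocycle f -> coboundary f.

(* The invariants take values in N u {+oo}, viewed inside \bar R; the infimum
   of the empty set is +oo. *)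
Definition inf_nat (R : realType) (S : set nat) : \bar R :=
  ereal_inf [set (n%:R)%:E | n in S].

Definition inj_dim (R : realType) X : \bar R :=
  inf_nat R [set n | exists I : coresolution X,
    (forall i, injective_mod (cores_obj I i)) /\
    (forall i, (n < i)%N -> zero_mod (cores_obj I i))].

Definition dell (R : realType) (j : nat) M : \bar R :=
  inf_nat R [set n | exists N K L : lmodType A,
    [/\ fin_gen N, is_syz n M K, is_syz (n + j) N L & stable_summand K L]].

Definition edell (R : realType) (k : nat) M : \bar R :=
  inf_nat R [set n | forall (k' : nat) X, (1 <= k')%N ->
    inj_dim R X = ((n + k - 1 + k')%:R)%:E -> ext_zero (n + k') M X].

Definition ddell (R : realType) (k : nat) M : \bar R :=
  inf_nat R [set m | exists n : nat, (n <= m)%N /\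
    exists C : resolution M,
      (forall i, (n < i)%N -> zero_mod (res_obj C i)) /\
      (forall i, (i <= n)%N -> fin_gen (res_obj C i) /\
         (dell R (i + k) (res_obj C i) <= ((m - i)%:R)%:E)%E)].

End Modules.

Section Algebras.
Variables (R : realType) (F : fieldType) (Lambda : falgType F).

Definition sup_simple (inv : rmodType Lambda -> \bar R) : \bar R :=
  ereal_sup [set v | exists S : rmodType Lambda, simple_mod S /\ inv S = v].

Definition dell_alg (k : nat) : \bar R := sup_simple (@dell _ R k).
Definition edell_alg (k : nat) : \bar R := sup_simple (@edell _ R k).
Definition ddell_alg (k : nat) : \bar R := sup_simple (@ddell _ R k).

End Algebras.

(* Main.v *)
Require Import Defs.
From HB Require Import structures.
From mathcomp Require Import all_boot all_order all_algebra all_field.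
From mathcomp Require Import all_classical all_reals ereal.

(** Fix [X] and an injective coresolution [I] of [X], and compute Ext(-, X) by
    [Hom(-, I)].  If [Omega^a C] is stably a summand of [Omega^(a + j) N], then
    dimension shifting makes [Ext^t(C, X)] a summand of [Ext^(t + j)(N, X)] for
    [t > a], which vanishes as soon as [id X < t + j].  For an exact sequence
    [0 -> C_n -> ... -> C_0 -> M -> 0] witnessing [k-ddell M <= m] and for
    [id X = m + k - 1 + k'], this gives [Ext^(m + k' - i)(C_i, X) = 0] for all
    [i], and splicing the long exact sequences yields [Ext^(m + k')(M, X) = 0].
    The second inequality uses the sequences of length [n = 0]. *)

Set Implicit Arguments.
Unset Strict Implicit.
Unset Printing Implicit Defensive.

Import Order.TTheory GRing.Theory Num.Theory.
Local Open Scope classical_set_scope.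
Local Open Scope ring_scope.

Arguments cores_aug_inj {A X} c.
Arguments cores_exact0 {A X} c y.
Arguments cores_exactS {A X} c i y.
Arguments res_exact0 {A M} r y.
Arguments res_exactS {A M} r i y.

(** * Linear maps built from choice functions, and kernels as modules *)

Section LinearMaps.
Variable A : nzRingType.
Implicit Types K L M N P X Y : lmodType A.

Lemma exists_linear M N (f : M -> N) :
  linear f -> exists g : {linear M -> N}, forall x, g x = f x.
Proof.
move=> lin_f.
pose lf := GRing.isLinear.Build A M N *:%R f lin_f.
by exists (HB.pack_for {linear M -> N} f lf).
Qed.

Lemma factor_surj M N Y (p : {linear M -> N}) (g : {linear M -> Y}) :
    surjective_fun p -> (forall x, p x = 0 -> g x = 0) ->
  exists h : {linear N -> Y}, forall x, h (p x) = g x.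
Proof.
move=> p_surj p0g0; have [s sP] := choice p_surj.
(* The section [s] is only set-theoretic; [gE] makes [g] composed with [s] linear. *)
have gE x y : p x = p y -> g x = g y.
  by move=> pxy; apply/subr0_eq; rewrite -linearB p0g0 // linearB pxy subrr.
have [h hE] : exists h : {linear N -> Y}, forall y, h y = g (s y).
  apply: exists_linear => a u v /=; rewrite -linearP; apply: gE.
  by rewrite linearP !sP.
by exists h => x; rewrite hE; apply: gE; rewrite sP.
Qed.

Lemma factor_inj M X Y (a : {linear X -> Y}) (g : {linear M -> Y}) :
    injective a -> (forall x, exists y, a y = g x) ->
  exists h : {linear M -> X}, forall x, a (h x) = g x.
Proof.
move=> a_inj im_g; have [s sP] := choice im_g.
have [h hE] : exists h : {linear M -> X}, forall x, h x = s x.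
  by apply: exists_linear => c u v /=; apply: a_inj; rewrite linearP !sP linearP.
by exists h => x; rewrite hE.
Qed.

Lemma linear_inverse M N (f : {linear M -> N}) :
  bijective f -> exists g : {linear N -> M}, cancel f g /\ cancel g f.
Proof.
move=> [g fK gK].
have [h hE] : exists h : {linear N -> M}, forall x, h x = g x.
  by apply: exists_linear => a u v; apply: (can_inj fK); rewrite linearP !gK.
by exists h; split=> x; rewrite hE.
Qed.

Lemma linear_inl M N :
  exists i : {linear M -> (M * N)%type}, forall x, i x = (x, 0).
Proof. by apply: exists_linear => a u v; congr pair; rewrite /= scaler0 addr0. Qed.

Lemma linear_inr M N :
  exists i : {linear N -> (M * N)%type}, forall y, i y = (0, y).
Proof. by apply: exists_linear => a u v; congr pair; rewrite /= scaler0 addr0. Qed.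

Definition ker_pred M N (f : {linear M -> N}) : {pred M} := fun x => f x == 0.

Lemma ker_pred_submod M N (f : {linear M -> N}) : submod_closed (ker_pred f).
Proof.
split; first by rewrite unfold_in linear0.
by move=> a u v; rewrite !unfold_in linearP => /eqP-> /eqP->; rewrite scaler0 addr0.
Qed.

HB.instance Definition _ M N (f : {linear M -> N}) :=
  GRing.isSubmodClosed.Build A M (ker_pred f) (ker_pred_submod f).

Record ker_mod M N (f : {linear M -> N}) :=
  KerMod { ker_val :> M; _ : ker_val \in ker_pred f }.

HB.instance Definition _ M N (f : {linear M -> N}) := [isSub for @ker_val M N f].
HB.instance Definition _ M N (f : {linear M -> N}) :=
  [Choice of ker_mod f by <:].
HB.instance Definition _ M N (f : {linear M -> N}) :=
  [SubChoice_isSubLmodule of ker_mod f by <:].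

Definition ker_incl M N (f : {linear M -> N}) : {linear ker_mod f -> M} := val.

Lemma ker_incl_inj M N (f : {linear M -> N}) : injective (ker_incl f).
Proof. exact: val_inj. Qed.

Lemma ker_incl_exact M N (f : {linear M -> N}) : exact_at (ker_incl f) f.
Proof.
move=> y; split=> [/eqP fy0 | [x <-]]; first by exists (KerMod fy0).
by case: x => x /= /eqP.
Qed.

Lemma ker_corestr L M N (g : {linear L -> M}) (f : {linear M -> N}) :
  exact_at g f -> exists h : {linear L -> ker_mod f}, forall x, val (h x) = g x.
Proof.
move=> ex; apply: (factor_inj (a := ker_incl f)); first exact: ker_incl_inj.
by move=> x; apply/ker_incl_exact/ex; exists x.
Qed.

End LinearMaps.

(** * Vanishing of Ext computed by an injective coresolution *)

Section InjectiveCoresolution.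
Variables (A : nzRingType) (X : lmodType A) (I : coresolution X).
Hypothesis I_inj : forall i, injective_mod (cores_obj I i).
Implicit Types K L M N P : lmodType A.

(* Says that [Ext^(t + 1)(M, X) = 0]; degree 0 is never needed. *)
Definition inj_acyclic (t : nat) M : Prop :=
  forall f : {linear M -> cores_obj I t.+1},
    (forall x, cores_d I t.+1 (f x) = 0) ->
  exists g : {linear M -> cores_obj I t}, forall x, f x = cores_d I t (g x).

Lemma cores_dd t y : cores_d I t.+1 (cores_d I t y) = 0.
Proof. by apply/(cores_exactS I t); exists y. Qed.

Lemma inj_acyclic_vanish t M : zero_mod (cores_obj I t.+1) -> inj_acyclic t M.
Proof. by move=> z f _; exists \0 => x /=; rewrite linear0 (z (f x)). Qed.

(** By exactness, [cores_d I t] maps onto the kernel of [cores_d I t.+1]. A cocycle takes values in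
    this kernel, so projectivity lifts it. *)
Lemma inj_acyclic_proj t P : projective_mod P -> inj_acyclic t P.
Proof.
move=> P_proj f df0.
have [h hE] : exists h : {linear P -> ker_mod (cores_d I t.+1)},
    forall x, val (h x) = f x.
  apply: (factor_inj (a := ker_incl (cores_d I t.+1))).
    exact: ker_incl_inj.
  by move=> x; apply/ker_incl_exact/df0.
have [d dE] := ker_corestr (cores_exactS I t).
have d_surj : surjective_fun d.
  move=> y; have /(cores_exactS I t)[x xE] : cores_d I t.+1 (val y) = 0.
    by apply/ker_incl_exact; exists y.
  by exists x; apply: val_inj; rewrite dE.
have [g gE] := P_proj _ _ d h d_surj.
by exists g => x; rewrite -hE -gE dE.
Qed.

Lemma inj_acyclic_retract t K L (s : {linear K -> L}) (r : {linear L -> K}) :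
  cancel s r -> inj_acyclic t L -> inj_acyclic t K.
Proof.
move=> sK acL f df0; have [x | g gE] := acL (f \o r); first exact: df0.
by exists (g \o s) => x /=; rewrite -gE /= sK.
Qed.

Lemma inj_acyclic_iso t M N : iso_mod M N -> inj_acyclic t M -> inj_acyclic t N.
Proof.
by move=> [f /linear_inverse[g [_ gK]]]; apply: inj_acyclic_retract gK.
Qed.

Lemma inj_acyclic_pair t M N :
  inj_acyclic t M -> inj_acyclic t N -> inj_acyclic t (M * N)%type.
Proof.
move=> acM acN f df0.
have [i iE] := linear_inl M N; have [j jE] := linear_inr M N.
have [x | g gE] := acM (f \o i); first exact: df0.
have [x | h hE] := acN (f \o j); first exact: df0.
exists ((g \o fst) \+ (h \o snd)) => -[x y] /=.
rewrite linearD -gE -hE /= -linearD iE jE; congr (f _).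
by congr pair; rewrite /= ?addr0 ?add0r.
Qed.

Lemma inj_acyclic_stable_summand t M N :
  stable_summand M N -> inj_acyclic t N -> inj_acyclic t M.
Proof.
move=> [P [C [P_proj [f /linear_inverse[h [fK _]]]]]] acN.
have [i iE] := linear_inl M C.
apply: (inj_acyclic_retract (s := f \o i) (r := fst \o h)).
  by move=> x /=; rewrite fK iE.
by apply: inj_acyclic_pair => //; apply: inj_acyclic_proj.
Qed.

Section ShortExact.
Variables (K C M : lmodType A) (i : {linear K -> C}) (p : {linear C -> M}).
Hypotheses (i_inj : injective i) (p_surj : surjective_fun p).
Hypothesis exact_ip : exact_at i p.

Let pi0 x : p (i x) = 0. Proof. by apply/exact_ip; exists x. Qed.

(** This is exactness of Ext^(t+1)(K, X) -> Ext^(t+2)(M, X) -> Ext^(t+2)(C, X) in the middle. *)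
Lemma inj_acyclic_quot t :
  inj_acyclic t K -> inj_acyclic t.+1 C -> inj_acyclic t.+1 M.
Proof.
move=> acK acC f df0.
have [x | g gE] := acC (f \o p); first exact: df0.
have [x | h hE] := acK (g \o i); first by rewrite -gE /= pi0 linear0.
(* Subtracting the coboundary of [h'] makes [g] vanish on the image of [i], so it descends to
   [M]. *)
have [h' h'E] := I_inj h i_inj.
have [|g' g'E] := factor_surj (g := g \- (cores_d I t \o h')) p_surj.
  by move=> x /exact_ip[y <-] /=; rewrite h'E -hE subrr.
exists g' => y; have [x <-] := p_surj y.
by rewrite g'E /= linearB cores_dd subr0 -gE.
Qed.

(** The connecting map Ext^(t+1)(K, X) -> Ext^(t+2)(M, X) is injective for projective [C]; [f2]
    below represents the image of the class of [f]. *)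
Lemma inj_acyclic_syzygy t :
  projective_mod C -> inj_acyclic t.+1 M -> inj_acyclic t K.
Proof.
move=> C_proj acM f df0.
have [f' f'E] := I_inj f i_inj.
have [|f2 f2E] := factor_surj (g := cores_d I t.+1 \o f') p_surj.
  by move=> x /exact_ip[y <-] /=; rewrite f'E df0.
have [y | g gE] := acM f2; first by have [x <-] := p_surj y; rewrite f2E cores_dd.
have [x | h hE] := inj_acyclic_proj C_proj (f := f' \- (g \o p)).
  by rewrite /= linearB -gE f2E subrr.
by exists (h \o i) => x /=; rewrite -hE /= pi0 linear0 subr0 f'E.
Qed.

(** The obstruction to extending [f] along [i] is a class in Ext^1(M, X), represented by [F']. Once
    it is a coboundary, the corrected extension of [f] lands in the image of [cores_aug I], that is,
    in [X]. *)
Lemma inj_acyclic_extend (f : {linear K -> X}) :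
  inj_acyclic 0 M -> exists g : {linear C -> X}, forall x, g (i x) = f x.
Proof.
move=> acM.
have [F FE] := I_inj (cores_aug I \o f) i_inj.
have aug0 x : cores_d I 0 (cores_aug I x) = 0.
  by apply/(cores_exact0 I); exists x.
have [|F' F'E] := factor_surj (g := cores_d I 0 \o F) p_surj.
  by move=> x /exact_ip[y <-] /=; rewrite FE aug0.
have [y | g gE] := acM F'; first by have [x <-] := p_surj y; rewrite F'E cores_dd.
have [x | h hE] := factor_inj (g := F \- (g \o p)) (cores_aug_inj I).
  by apply/(cores_exact0 I); rewrite /= linearB -gE F'E subrr.
exists h => x; apply: (cores_aug_inj I).
by rewrite hE /= pi0 linear0 subr0 FE.
Qed.

End ShortExact.

Lemma inj_acyclic_is_syz n t M K :
  is_syz n M K -> inj_acyclic t K <-> inj_acyclic (n + t) M.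
Proof.
elim: n t K => [|n IHn] t K /=.
  move=> iso; split; last exact: inj_acyclic_iso.
  by case: iso => f /linear_inverse[g [fK _]]; apply: inj_acyclic_retract fK.
move=> [L [/IHn-IH [P [p [i [[P_proj p_surj _] i_inj ex]]]]]].
rewrite addSnnS -IH; split; last exact: inj_acyclic_syzygy ex _ P_proj.
move=> acK; apply: inj_acyclic_quot i_inj p_surj ex _ acK _.
exact: inj_acyclic_proj.
Qed.

End InjectiveCoresolution.

(** * Passing to the first syzygy of a resolution, and splicing *)

Section Resolutions.
Variable A : nzRingType.
Implicit Types M X : lmodType A.

Lemma shift_resolution_exists M (C : resolution M) :
  exists D : {linear res_obj C 1 -> ker_mod (res_aug C)},
    [/\ forall x, val (D x) = res_d C 0 x, surjective_fun D
      & exact_at (res_d C 1) D].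
Proof.
have [D DE] := ker_corestr (res_exact0 C); exists D; split=> // y.
  have /(res_exact0 C)[x xE] : res_aug C (val y) = 0.
    by apply/ker_incl_exact; exists y.
  by exists x; apply: val_inj; rewrite DE.
rewrite -(res_exactS C 0 y) -DE; split=> [-> | Dy0]; first exact: linear0.
by apply: val_inj; rewrite Dy0 [RHS]linear0.
Qed.

Definition shift_resolution M (C : resolution M)
    (D : {linear res_obj C 1 -> ker_mod (res_aug C)}) (D_surj : surjective_fun D)
    (D_exact : exact_at (res_d C 1) D) : resolution (ker_mod (res_aug C)) :=
  Resolution (res_d := fun i => res_d C i.+1) D_surj D_exact
    (fun i => res_exactS C i.+1).

(** Half of the balancing of Ext, by induction along the kernels of a projective resolution. *)
Lemma inj_acyclic_ext_zero X (I : coresolution X) t M :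
    (forall i, injective_mod (cores_obj I i)) ->
  inj_acyclic I t M -> ext_zero t.+1 M X.
Proof.
move=> I_inj; elim: t M => [|t IHt] M acM P P_proj f fd0;
  have [D [DE D_surj D_ex]] := shift_resolution_exists P.
  (* In degree 1, a cocycle descends to the kernel of the augmentation; an extension of it to
     [res_obj P 0] exhibits it as a coboundary. *)
  have [x /D_ex[y <-] | f1 f1E] := factor_surj (g := f) D_surj; first exact: fd0.
  have [g gE] := inj_acyclic_extend I_inj (@ker_incl_inj _ _ _ _)
    (res_aug_surj P) (@ker_incl_exact _ _ _ _) f1 acM.
  by exists g => x; rewrite -DE -[val _]/(ker_incl _ (D x)) gE f1E.
have acK := inj_acyclic_syzygy I_inj (@ker_incl_inj _ _ _ _)
  (res_aug_surj P) (@ker_incl_exact _ _ _ _) (P_proj 0%N) acM.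
(* Cocycles and coboundaries of the shifted resolution in degree [t.+1] are by conversion those of
   [P] in degree [t.+2]. *)
exact: (IHt _ acK (shift_resolution D_surj D_ex) (fun i => P_proj i.+1) f fd0).
Qed.

Lemma inj_acyclic_resolution X (I : coresolution X) n t M (C : resolution M) :
    (forall i, injective_mod (cores_obj I i)) -> (n <= t)%N ->
    (forall i, (n < i)%N -> zero_mod (res_obj C i)) ->
    (forall i, (i <= n)%N -> inj_acyclic I (t - i) (res_obj C i)) ->
  inj_acyclic I t M.
Proof.
move=> I_inj; elim: n t M C => [|n IHn] t M C le_nt Cz acC.
  (* For [n = 0] the augmentation is bijective, since [res_obj C 1] is zero. *)
  have C0 := acC 0%N (leqnn _); rewrite subn0 in C0.
  have aug0 x : res_aug C x = 0 -> x = 0.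
    by move=> /(res_exact0 C)[y <-]; rewrite (Cz 1%N _ y) // linear0.
  move=> f df0; have [x | g gE] := C0 (f \o res_aug C); first exact: df0.
  have [x /aug0-> | g' g'E] := factor_surj (g := g) (res_aug_surj C).
    exact: linear0.
  exists g' => y; have [x <-] := res_aug_surj C y.
  by rewrite g'E -gE.
case: t le_nt acC => // t le_nt acC.
have [D [DE D_surj D_ex]] := shift_resolution_exists C.
apply: (inj_acyclic_quot I_inj (@ker_incl_inj _ _ _ _)
  (res_aug_surj C) (@ker_incl_exact _ _ _ _)); last exact: acC 0%N _.
apply: (IHn _ _ (shift_resolution D_surj D_ex)) => // i lei.
  exact: Cz i.+1 lei.
exact: acC i.+1 lei.
Qed.

Definition trivial_resolution_obj M (i : nat) : lmodType A :=
  if i is 0 then M else 'rV[A]_0.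

(** An equality of modules, rather than an isomorphism, lets [dell] of the degree 0 term be
    rewritten to [dell] of [M]. *)
Lemma trivial_resolution M : exists C : resolution M,
  res_obj C 0 = M /\ forall i, (0 < i)%N -> zero_mod (res_obj C i).
Proof.
pose d i : {linear trivial_resolution_obj M i.+1 -> trivial_resolution_obj M i}
  := \0.
have z i : zero_mod (trivial_resolution_obj M i.+1).
  by move=> x; apply: thinmx0.
have aug_surj : surjective_fun (idfun : {linear trivial_resolution_obj M 0 -> M}).
  by move=> y; exists y.
have ex0 : exact_at (d 0%N) (idfun : {linear trivial_resolution_obj M 0 -> M}).
  by move=> y; split=> /= [-> | [x <-] //]; exists 0.
have exS i : exact_at (d i.+1) (d i).
  by move=> y; split=> [_ | [x <-] //]; exists 0; rewrite (z i y).
by exists (Resolution aug_surj ex0 exS); split=> // -[|i] // _; apply: z.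
Qed.

(** The cyclic submodule generated by a nonzero [e] is everything. Finite generation is what allows
    [M] itself as the term C_0 in [ddell]. *)
Lemma simple_fin_gen M : simple_mod M -> fin_gen M.
Proof.
move=> [[e e0] simM].
pose U : {pred M} := fun x => `[< exists a : A, x = a *: e >].
have U_closed : submod_closed U.
  split; first by apply/asboolP; exists 0; rewrite scale0r.
  move=> c u v /asboolP[a ->] /asboolP[b ->]; apply/asboolP.
  by exists (c * a + b); rewrite scalerDl scalerA.
have [U0 | UT] := simM U U_closed.
  by case: e0; apply: U0; apply/asboolP; exists 1; rewrite scale1r.
exists 1%N, (fun=> e) => x; have /asboolP[a ->] := UT x.
by exists (fun=> a); rewrite big_ord1.
Qed.

End Resolutions.

(** * Comparison of the invariants *)

Section Invariants.
Variables (R : realType) (A : nzRingType).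
Implicit Types M X : lmodType A.

Lemma inf_nat_le (S : set nat) (n : nat) : S n -> (inf_nat R S <= n%:R%:E)%E.
Proof. by move=> Sn; apply: ereal_inf_lbound; exists n. Qed.

Lemma inf_nat_leP (S : set nat) (n : nat) :
  (inf_nat R S <= n%:R%:E)%E -> exists2 m, S m & (m <= n)%N.
Proof.
move=> le_inf; apply: contrapT => noS.
(* If no element of [S] is at most [n], integrality makes [n.+1] a lower bound. *)
suff : (n.+1%:R%:E <= inf_nat R S)%E.
  by move=> /le_trans/(_ le_inf); rewrite lee_fin ler_nat ltnn.
apply: le_ereal_inf_tmp => _ [m Sm <-]; rewrite lee_fin ler_nat ltnNge.
by apply/negP => le_mn; apply: noS; exists m.
Qed.

Lemma inj_acyclic_dell X (I : coresolution X) D j d t M :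
    (forall i, injective_mod (cores_obj I i)) ->
    (forall i, (D < i)%N -> zero_mod (cores_obj I i)) ->
    (dell R j M <= d%:R%:E)%E -> (d <= t)%N -> (D <= t + j)%N ->
  inj_acyclic I t M.
Proof.
move=> I_inj Iz /inf_nat_leP[n [N [K [L [_ syzK syzL sKL]]]] le_nd] le_dt le_D.
have le_nt := leq_trans le_nd le_dt.
(* Shift down by [n] from [M] to [K], pass to [L], then shift up by [n + j] to [N], where the term
   of [I] in degree [t + j + 1] is zero. *)
rewrite -(subnKC le_nt); apply/(inj_acyclic_is_syz I_inj _ syzK).
apply: inj_acyclic_stable_summand sKL _.
apply/(inj_acyclic_is_syz I_inj _ syzL)/inj_acyclic_vanish/Iz.
by rewrite ltnS addnAC subnKC.
Qed.

Lemma edell_le_ddell k M : (1 <= k)%N -> (edell R k M <= ddell R k M)%E.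
Proof.
move=> k_gt0; apply: le_ereal_inf_tmp => _ [m [n [le_nm [C [Cz CP]]]] <-].
(* From here [k'.+1] stands for the k' of the definition, so the splicing is done with
   [t = m + k']. *)
apply: inf_nat_le => -[//|k'] X _ idX.
have [D [I [I_inj Iz]] le_D] :
    exists2 D, (exists I : coresolution X,
      (forall i, injective_mod (cores_obj I i)) /\
      (forall i, (D < i)%N -> zero_mod (cores_obj I i)))
    & (D <= m + k - 1 + k'.+1)%N.
  by apply: inf_nat_leP; rewrite -/(inj_dim R X) idX.
rewrite addnS; apply: (inj_acyclic_ext_zero I_inj).
apply: (inj_acyclic_resolution I_inj _ Cz); first exact: leq_trans (leq_addr _ _).
move=> i le_in; have [_ dellC] := CP i le_in.
have le_im := leq_trans le_in le_nm.
apply: (inj_acyclic_dell I_inj Iz dellC); first by rewrite leq_sub2r ?leq_addr.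
(* Both sides equal [m + k + k']: the [i] lost in the degree is regained in [i + k], and [k_gt0]
   keeps the subtraction of 1 from truncating. *)
apply: leq_trans le_D _.
rewrite addnA subnK ?(leq_trans le_im) ?leq_addr //.
by rewrite addnS -addSn subn1 prednK ?addn_gt0 ?k_gt0 ?orbT // addnAC.
Qed.

Lemma ddell_le_dell k M : fin_gen M -> (ddell R k M <= dell R k M)%E.
Proof.
move=> fgM; apply: le_ereal_inf_tmp => _ [m dm <-]; apply: inf_nat_le.
exists 0%N; split=> //; have [C [C0 Cz]] := trivial_resolution M.
exists C; split=> // i; rewrite leqn0 => /eqP->; rewrite C0 subn0.
by split=> //; apply: inf_nat_le.
Qed.

End Invariants.

Lemma sup_simple_le (R : realType) (F : fieldType) (Lambda : falgType F)
    (f g : rmodType Lambda -> \bar R) :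
  (forall S, simple_mod S -> (f S <= g S)%E) ->
  (sup_simple f <= sup_simple g)%E.
Proof.
move=> le_fg; apply: ge_ereal_sup => _ [S [simS <-]].
by apply: le_trans (le_fg S simS) _; apply: ereal_sup_ubound; exists S.
Qed.

Theorem mainTheorem6 (R : realType) (F : fieldType) (Lambda : falgType F)
    (k : nat) (hk : (1 <= k)%N) :
  (edell_alg R Lambda k <= ddell_alg R Lambda k)%E /\
  (ddell_alg R Lambda k <= dell_alg R Lambda k)%E.
Proof.
split; apply: sup_simple_le => S simS; first exact: edell_le_ddell.
exact/ddell_le_dell/simple_fin_gen.
Qed.
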